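(* Let $f_{\boldsymbol{W}}(\mathbf{x}) = \mathbf{W}^{L}\rho(\mathbf{W}^{L-1}\cdots\rho(\mathbf{W}^{1}\mathbf{x})\cdots)\in\mathbb{R}^K$ be an $L$-layer neural network with weight matrices $\boldsymbol{W}=\{\mathbf{W}^m\}_{m=1}^L$, input $\mathbf{x}\in\mathbb{R}^{d_0}$, and activation $\rho$ that is non-negative, monotone and $1$-Lipschitz, applied element-wise. Fix $N\in\{1,\dots,L\}$ and $\epsilon_N,\epsilon_{\mathbf{x}}\ge 0$. Let $\hat{\mathbf{W}}^N$ be a matrix of the same size as $\mathbf{W}^N$ with $|\hat W^N_{a,b}-W^N_{a,b}|\le\epsilon_N$ for all $a,b$, let $\hat{\mathbf{x}}\in\mathbb{R}^{d_0}$ satisfy $|[\hat{\mathbf{x}}]_b-[\mathbf{x}]_b|\le\epsilon_{\mathbf{x}}$ for all $b$, and let $f_{\widehat{\boldsymbol{W}}}(\hat{\mathbf{x}})$ be the output of the same network on input $\hat{\mathbf{x}}$ with $\mathbf{W}^N$ replaced by $\hat{\mathbf{W}}^N$ and all other weight matrices unchanged. Then for all classes $i,j\in\{1,\dots,K\}$, the pairwise margins satisfy: (1) if $N\neq L$, $$f^{ij}_{\widehat{\boldsymbol{W}}}(\hat{\mathbf{x}}) \le f^{ij}_{\boldsymbol{W}}(\mathbf{x}) + \|W^{L}_{i,:}-W^{L}_{j,:}\|_1\prod_{k=1}^{L-N-1}\|\mathbf{W}^{L-k}\|_\infty\Big\{\epsilon_N\|\mathbf{z}^{N-1}_{\boldsymbol{W}}\|_1+\epsilon_{\mathbf{x}}\Big(\prod_{m=1}^{N-1}\|\mathbf{W}^m\|_\infty\Big)\big(\|\mathbf{W}^N\|_\infty+d_N\epsilon_N\big)\Big\};$$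 (2) if $N=L$, $$f^{ij}_{\widehat{\boldsymbol{W}}}(\hat{\mathbf{x}}) \le f^{ij}_{\boldsymbol{W}}(\mathbf{x}) + \epsilon_{\mathbf{x}}\|W^{L}_{i,:}-W^{L}_{j,:}\|_1\prod_{m=1}^{L-1}\|\mathbf{W}^m\|_\infty + 2\epsilon_L\Big(\prod_{m=1}^{L-1}\|\mathbf{W}^m\|_1\Big)\big(\|\mathbf{x}\|_1+d_0\epsilon_{\mathbf{x}}\big).$$ Here $d_N$ is the dimension of the row vectors of $\mathbf{W}^N$ (its number of columns) and $d_0$ is the dimension of the input $\mathbf{x}$.
   Context: All matrices and vectors are real, with compatible sizes. $W_{i,:}$ denotes the $i$-th row of $\mathbf{W}$, $W_{i,j}$ its $(i,j)$ entry, and $[\mathbf{x}]_i$ the $i$-th entry of $\mathbf{x}$. For a vector, $\|\cdot\|_1$ is the $\ell_1$ norm; for a matrix, $\|\mathbf{W}\|_p:=\max_{\mathbf{v}\ne 0}\|\mathbf{W}\mathbf{v}\|_p/\|\mathbf{v}\|_p$ is the induced norm (so $\|\mathbf{W}\|_\infty$ is the maximum absolute row sum and $\|\mathbf{W}\|_1$ the maximum absolute column sum). The pairwise margin of a network $f$ with values in $\mathbb{R}^K$ is $f^{ij}(\mathbf{x}):=[f(\mathbf{x})]_i-[f(\mathbf{x})]_j$. For $1\le k\le L-1$, the output of the $k$-th layer of the unperturbed network on the unperturbed input is $\mathbf{z}^k_{\boldsymbol{W}}:=\rho(\mathbf{W}^k\cdots\rho(\mathbf{W}^1\mathbf{x})\cdots)$,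 and $\mathbf{z}^0_{\boldsymbol{W}}:=\mathbf{x}$. Empty products equal $1$.
   Formalization: Part (2) additionally assumes L = 1 or ρ(0) = 0: as stated it fails for L ≥ 2, e.g. L = N = 2, ρ ≡ 1, W¹ = W² = 0, x = x̂ = 0, ε_x = 0, ε_2 = 1, Ŵ² = [[1,1],[-1,-1]] gives perturbed margin 4 but bound 0. *)

(* Defs.v *)
From HB Require Import structures.
From mathcomp Require Import all_boot all_order all_algebra.
From mathcomp Require Import boolp classical_sets reals topology normedtype.
Set Implicit Arguments.
Unset Strict Implicit.
Unset Printing Implicit Defensive.
Import Order.TTheory GRing.Theory Num.Theory.
Import numFieldNormedType.Exports.
Local Open Scope ring_scope.
Local Open Scope classical_set_scope.

(* Meant for row and column vectors only: on a general matrix this is the sum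
   of all |entries|, not an induced norm. *)
Definition l1norm (R : realType) (m n : nat) (v : 'M[R]_(m, n)) : R :=
  \sum_i \sum_j `|v i j|.

(* The l_oo norm of a vector is the library's [mx_norm] (largest |entry|). *)
Definition linfnorm (R : realType) (m n : nat) (v : 'M[R]_(m, n)) : R :=
  mx_norm v.

(* max over v != 0 of nu (W v) / nu v. For n > 0 the maximum exists and [sup]
   is its value; for n = 0 there is no v != 0 and the value is [sup set0] = 0. *)
Definition induced_norm (R : realType) (nu : forall k, 'cV[R]_k -> R)
    (m n : nat) (W : 'M[R]_(m, n)) : R :=
  sup [set nu m (W *m v) / nu n v | v in [set v : 'cV[R]_n | v != 0]].

Definition opnorm1 (R : realType) (m n : nat) (W : 'M[R]_(m, n)) : R :=
  induced_norm (fun k => @l1norm R k 1) W.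

Definition opnorm_inf (R : realType) (m n : nat) (W : 'M[R]_(m, n)) : R :=
  induced_norm (fun k => @linfnorm R k 1) W.

(* Weight matrices are numbered from 1: W m maps layer m.-1, of width d m.-1,
   to layer m, of width d m. An L-layer network only reads W 1, ..., W L;
   W 0 and W m for m > L are dummies. *)
Definition weights (R : realType) (d : nat -> nat) : Type :=
  forall m : nat, 'M[R]_(d m, d m.-1).

Fixpoint layer (R : realType) (d : nat -> nat) (rho : R -> R)
    (W : weights R d) (x : 'cV[R]_(d 0)) (k : nat) : 'cV[R]_(d k) :=
  if k is k'.+1 then map_mx rho (W k'.+1 *m layer rho W x k') else x.

(* The last layer carries no activation. Meaningful for L >= 1. *)
Definition network (R : realType) (d : nat -> nat) (rho : R -> R)
    (W : weights R d) (L : nat) (x : 'cV[R]_(d 0)) : 'cV[R]_(d L) :=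
  W L *m layer rho W x L.-1.

Definition margin (R : realType) (K : nat) (y : 'cV[R]_K) (i j : 'I_K) : R :=
  y i 0 - y j 0.

Definition replace_weight (R : realType) (d : nat -> nat) (W : weights R d)
    (N : nat) (WN : 'M[R]_(d N, d N.-1)) : weights R d :=
  dfwith W WN.

(* Monotone in either direction. *)
Definition monotone (R : realType) (rho : R -> R) : Prop :=
  {homo rho : s t / s <= t} \/ {homo rho : s t /~ s <= t}.

(* Main.v *)
(* Telescoping through the layers. Since the activation is 1-Lipschitz, each
   unperturbed layer amplifies the l_oo distance between the two runs by at most
   its l_oo operator norm. At the perturbed layer,
     WN v - W u = (WN - W) u + W (v - u) + (WN - W) (v - u),
   and an entrywise bound on WN - W turns l1 norms into l_oo norms. At the output
   layer, margins are the functionals (row i - row j), bounded through the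
   l1/l_oo duality. When N = L the error term (WN - W) zh is instead controlled by
   the l1 norm of the last hidden layer, which propagates through l1 operator
   norms because rho 0 = 0 gives |rho t| <= |t|. *)

Require Import Defs.
From HB Require Import structures.
From mathcomp Require Import all_boot all_order all_algebra.
From mathcomp Require Import boolp classical_sets reals topology normedtype.
From mathcomp Require Import zify ring.
Set Implicit Arguments.
Unset Strict Implicit.
Unset Printing Implicit Defensive.
Import Order.TTheory GRing.Theory Num.Theory.
Import numFieldNormedType.Exports.
Local Open Scope ring_scope.

(** * Entrywise norms of vectors and l1/l_oo duality *)

Section Norms.
Context {R : realType}.
Implicit Types m n : nat.

Lemma l1norm_ge0 m n (A : 'M[R]_(m, n)) : 0 <= l1norm A.
Proof. by apply: sumr_ge0 => i _; apply: sumr_ge0. Qed.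

Lemma l1norm_col n (v : 'cV[R]_n) : l1norm v = \sum_i `|v i 0|.
Proof. by apply: eq_bigr => i _; rewrite big_ord1. Qed.

Lemma l1norm_row n (v : 'rV[R]_n) : l1norm v = \sum_j `|v 0 j|.
Proof. by rewrite /l1norm big_ord1. Qed.

Lemma linfnorm_ge0 m n (A : 'M[R]_(m, n)) : 0 <= linfnorm A.
Proof. by rewrite /linfnorm mx_normrE; apply: bigmax_ge_id. Qed.

Lemma coef_le_linfnorm m n (A : 'M[R]_(m, n)) i j : `|A i j| <= linfnorm A.
Proof.
rewrite /linfnorm mx_normrE.
exact: (le_bigmax _ (fun ij : 'I_m * 'I_n => `|A ij.1 ij.2|) (i, j)).
Qed.

Lemma linfnorm_le m n (A : 'M[R]_(m, n)) (c : R) :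
  0 <= c -> (forall i j, `|A i j| <= c) -> linfnorm A <= c.
Proof. by move=> c0 Ac; rewrite /linfnorm mx_normrE; apply: bigmax_le. Qed.

Lemma linfnorm_col_le n (v : 'cV[R]_n) (c : R) :
  0 <= c -> (forall i, `|v i 0| <= c) -> linfnorm v <= c.
Proof. by move=> c0 vc; apply: linfnorm_le => // i j; rewrite ord1. Qed.

Lemma linfnorm_le_l1norm n (v : 'cV[R]_n) : linfnorm v <= l1norm v.
Proof.
apply: linfnorm_col_le => [|i]; first exact: l1norm_ge0.
by rewrite l1norm_col (bigD1 i) //= lerDl sumr_ge0.
Qed.

Lemma linfnorm_gt0 n (v : 'cV[R]_n) : v != 0 -> 0 < linfnorm v.
Proof.
move=> v0; rewrite lt_neqAle linfnorm_ge0 andbT eq_sym.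
by apply: contra_neq v0; apply: mx_norm_eq0.
Qed.

Lemma abs_mulmx_le m n p (A : 'M[R]_(m, n)) (B : 'M[R]_(n, p)) i j :
  `|(A *m B) i j| <= \sum_k `|A i k| * `|B k j|.
Proof.
rewrite mxE (le_trans (ler_norm_sum _ _ _)) //.
by apply: ler_sum => k _; rewrite normrM.
Qed.

Lemma abs_mulmx_le_linfnorm m n (A : 'M[R]_(m, n)) (v : 'cV[R]_n) i :
  `|(A *m v) i 0| <= (\sum_j `|A i j|) * linfnorm v.
Proof.
apply: le_trans; first exact: abs_mulmx_le.
rewrite mulr_suml.
by apply: ler_sum => j _; rewrite ler_wpM2l // coef_le_linfnorm.
Qed.

Lemma abs_mulmx_le_l1norm m n (A : 'M[R]_(m, n)) (v : 'cV[R]_n) (c : R) i :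
  (forall j, `|A i j| <= c) -> `|(A *m v) i 0| <= c * l1norm v.
Proof.
move=> Ac; apply: le_trans; first exact: abs_mulmx_le.
rewrite l1norm_col mulr_sumr.
by apply: ler_sum => j _; rewrite ler_wpM2r.
Qed.

Lemma l1norm_mulmx_le m n (A : 'M[R]_(m, n)) (v : 'cV[R]_n) :
  l1norm (A *m v) <= l1norm A * linfnorm v.
Proof.
rewrite l1norm_col mulr_suml; apply: ler_sum => i _.
exact: abs_mulmx_le_linfnorm.
Qed.

Lemma l1norm_le_linfnorm n (v : 'cV[R]_n) : l1norm v <= n%:R * linfnorm v.
Proof.
rewrite l1norm_col mulr_natl -[X in _ *+ X](card_ord n) -sumr_const.
by apply: ler_sum => i _; apply: coef_le_linfnorm.
Qed.

Lemma ler_l1norm n (u v : 'cV[R]_n) :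
  (forall i, `|u i 0| <= `|v i 0|) -> l1norm u <= l1norm v.
Proof. by move=> uv; rewrite !l1norm_col; apply: ler_sum. Qed.

Lemma ler_l1normD n (u v : 'cV[R]_n) : l1norm (u + v) <= l1norm u + l1norm v.
Proof.
rewrite !l1norm_col -big_split; apply: ler_sum => i _.
by rewrite mxE ler_normD.
Qed.

(** * Induced norms for an abstract family of vector norms *)

Section InducedNorm.
Variable nu : forall k, 'cV[R]_k -> R.
Hypothesis nu0 : forall k, nu (0 : 'cV_k) = 0.
Hypothesis nu_gt0 : forall k (v : 'cV_k), v != 0 -> 0 < nu v.
Hypothesis nu_bounded : forall m n (W : 'M[R]_(m, n)),
  exists C, forall v : 'cV_n, nu (W *m v) <= C * nu v.

Lemma nu_ge0 k (v : 'cV_k) : 0 <= nu v.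
Proof. by have [->|/nu_gt0/ltW//] := eqVneq v 0; rewrite nu0. Qed.

(** A supremum dominates its members only when the set is bounded above; [nu_bounded] supplies that
    bound. *)
Lemma quotient_le_induced_norm m n (W : 'M[R]_(m, n)) (v : 'cV_n) :
  v != 0 -> nu (W *m v) / nu v <= induced_norm (@nu) W.
Proof.
move=> v0; apply: ub_le_sup; last by exists v.
have [C WC] := nu_bounded W; exists C => _ [u /= u0 <-].
by rewrite ler_pdivrMr ?nu_gt0.
Qed.

Lemma induced_norm_ge0 m n (W : 'M[R]_(m, n)) : 0 <= induced_norm (@nu) W.
Proof.
(* If every vector is zero, the set of quotients is empty and [sup] takes its default value 0.
   Otherwise any quotient is a non-negative lower bound for the supremum. *)
have [v0|/existsNP[v /eqP v0]] := pselect (forall v : 'cV[R]_n, v = 0).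
  rewrite /induced_norm (_ : [set _ | _ in _]%classic = set0) ?sup0 //.
  by rewrite -subset0 => _ [v /= + _]; rewrite (v0 v) eqxx.
by apply: le_trans (quotient_le_induced_norm W v0); rewrite divr_ge0 ?nu_ge0.
Qed.

Lemma nu_mulmx_le m n (W : 'M[R]_(m, n)) (v : 'cV_n) :
  nu (W *m v) <= induced_norm (@nu) W * nu v.
Proof.
have [->|v0] := eqVneq v 0; first by rewrite mulmx0 !nu0 mulr0.
by rewrite -ler_pdivrMr ?nu_gt0 //; apply: quotient_le_induced_norm.
Qed.

End InducedNorm.

(** * The l1 and l_oo operator norms *)

Lemma linfnorm0 m n : linfnorm (0 : 'M[R]_(m, n)) = 0.
Proof. exact: mx_norm0. Qed.

Lemma l1norm0 m n : l1norm (0 : 'M[R]_(m, n)) = 0.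
Proof. by apply: big1 => i _; apply: big1 => j _; rewrite mxE normr0. Qed.

Lemma l1norm_gt0 n (v : 'cV[R]_n) : v != 0 -> 0 < l1norm v.
Proof.
by move=> /linfnorm_gt0 /lt_le_trans; apply; apply: linfnorm_le_l1norm.
Qed.

(** Only finiteness of the supremum is at stake here, so a crude constant suffices: the sum of all
    absolute entries of [W], which also serves for l_oo below. *)
Lemma l1norm_mulmx_bounded m n (W : 'M[R]_(m, n)) :
  exists C, forall v : 'cV_n, l1norm (W *m v) <= C * l1norm v.
Proof.
exists (l1norm W) => v; apply: le_trans; first exact: l1norm_mulmx_le.
by rewrite ler_wpM2l ?l1norm_ge0 ?linfnorm_le_l1norm.
Qed.

Lemma linfnorm_mulmx_bounded m n (W : 'M[R]_(m, n)) :
  exists C, forall v : 'cV_n, linfnorm (W *m v) <= C * linfnorm v.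
Proof.
exists (l1norm W) => v; apply: le_trans; first exact: linfnorm_le_l1norm.
exact: l1norm_mulmx_le.
Qed.

Lemma opnorm1_ge0 m n (W : 'M[R]_(m, n)) : 0 <= opnorm1 W.
Proof.
apply: induced_norm_ge0 => [k|k v|m' n' W']; first exact: l1norm0.
- exact: l1norm_gt0.
- exact: l1norm_mulmx_bounded.
Qed.

Lemma opnorm_inf_ge0 m n (W : 'M[R]_(m, n)) : 0 <= opnorm_inf W.
Proof.
apply: induced_norm_ge0 => [k|k v|m' n' W']; first exact: linfnorm0.
- exact: linfnorm_gt0.
- exact: linfnorm_mulmx_bounded.
Qed.

Lemma l1norm_le_opnorm1 m n (W : 'M[R]_(m, n)) (v : 'cV_n) :
  l1norm (W *m v) <= opnorm1 W * l1norm v.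
Proof.
apply: (nu_mulmx_le (nu := fun k => @l1norm R k 1)) => [k|k u|m' n' W'].
- exact: l1norm0.
- exact: l1norm_gt0.
- exact: l1norm_mulmx_bounded.
Qed.

Lemma linfnorm_le_opnorm_inf m n (W : 'M[R]_(m, n)) (v : 'cV_n) :
  linfnorm (W *m v) <= opnorm_inf W * linfnorm v.
Proof.
apply: (nu_mulmx_le (nu := fun k => @linfnorm R k 1)) => [k|k u|m' n' W'].
- exact: linfnorm0.
- exact: linfnorm_gt0.
- exact: linfnorm_mulmx_bounded.
Qed.

(** * Margins as linear functionals *)

Lemma margin_mulmx m n (A : 'M[R]_(m, n)) (u : 'cV_n) i j :
  margin (A *m u) i j = ((row i A - row j A) *m u) 0 0.
Proof. by rewrite mulmxBl -!row_mul /margin !mxE. Qed.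

Lemma margin_mulmx_le m n (A : 'M[R]_(m, n)) (u : 'cV_n) i j :
  margin (A *m u) i j <= l1norm (row i A - row j A) * linfnorm u.
Proof.
rewrite margin_mulmx l1norm_row (le_trans (ler_norm _)) //.
exact: abs_mulmx_le_linfnorm.
Qed.

(** The factor 2 arises because each entry of [row i A - row j A] is a difference of two entries
    bounded by [c]. *)
Lemma margin_mulmx_entrywise_le m n (A : 'M[R]_(m, n)) (u : 'cV_n) (c : R) i j :
  (forall a b, `|A a b| <= c) -> margin (A *m u) i j <= 2 * c * l1norm u.
Proof.
move=> Ac; rewrite margin_mulmx (le_trans (ler_norm _)) //.
apply: abs_mulmx_le_l1norm => k; rewrite !mxE (le_trans (ler_normB _ _)) //.
by rewrite mulr_natl mulr2n lerD.
Qed.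

Lemma marginN n (u : 'cV[R]_n) i j : margin (- u) i j = - margin u i j.
Proof. by rewrite /margin !mxE opprB opprK addrC. Qed.

Lemma marginD n (u v : 'cV[R]_n) i j :
  margin (u + v) i j = margin u i j + margin v i j.
Proof. by rewrite /margin !mxE; ring. Qed.

End Norms.

(** * Propagation of norms and distances through the layers *)

Section Layers.
Context {R : realType} {d : nat -> nat} {rho : R -> R}.
Implicit Types (V W : weights R d) (x y : 'cV[R]_(d 0)).

Lemma eq_layer V W x k :
  (forall m, (0 < m <= k)%N -> V m = W m) -> layer rho V x k = layer rho W x k.
Proof.
elim: k => //= k IH VW; rewrite VW ?leqnn// IH// => m /andP[m0 mk].
by apply: VW; rewrite m0 leqW.
Qed.

Lemma l1norm_layer_le W x k : (forall t, `|rho t| <= `|t|) ->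
  l1norm (layer rho W x k) <= (\prod_(1 <= m < k.+1) opnorm1 (W m)) * l1norm x.
Proof.
move=> rho_le; elim: k => [|k IH] /=; first by rewrite big_nil mul1r.
rewrite big_nat_recr //= (mulrC (\prod_(_ <= _ < _) _)) -mulrA.
apply: le_trans (ler_wpM2l (opnorm1_ge0 _) IH).
apply: le_trans; last exact: l1norm_le_opnorm1.
by apply: ler_l1norm => i; rewrite mxE.
Qed.

Hypothesis rho_lip : forall s t, `|rho s - rho t| <= `|s - t|.

Lemma linfnorm_map_le n (u v : 'cV[R]_n) :
  linfnorm (map_mx rho u - map_mx rho v) <= linfnorm (u - v).
Proof.
apply: linfnorm_col_le => [|i]; first exact: linfnorm_ge0.
by rewrite !mxE; apply: le_trans (coef_le_linfnorm _ i 0); rewrite !mxE.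
Qed.

(** The weights need to agree only strictly above layer [n], so this applies both before the
    perturbed layer, starting from the inputs, and after it, starting from its output. *)
Lemma layer_dist_le V W y x n k : (n <= k)%N ->
    (forall m, (n < m <= k)%N -> V m = W m) ->
  linfnorm (layer rho V y k - layer rho W x k) <=
  (\prod_(n.+1 <= m < k.+1) opnorm_inf (W m)) *
    linfnorm (layer rho V y n - layer rho W x n).
Proof.
elim: k => [|k IH].
  by rewrite leqn0 => /eqP-> _; rewrite big_nil mul1r.
rewrite leq_eqVlt => /predU1P[->|nk VW]; first by rewrite big_geq ?mul1r.
rewrite big_nat_recr //= (mulrC (\prod_(_ <= _ < _) _)) -mulrA.
apply: le_trans; first exact: linfnorm_map_le.
rewrite VW ?nk ?leqnn // -mulmxBr.
apply: le_trans; first exact: linfnorm_le_opnorm_inf.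
rewrite ler_wpM2l ?opnorm_inf_ge0 // IH // => m /andP[nm mk].
by rewrite VW // nm leqW.
Qed.

End Layers.

(** Expanding around [u] leaves only the unperturbed vector in l1 norm. The l1 norm of [v - u] is
    traded for [n%:R] times its l_oo norm, the source of the dimension factor. *)
Lemma linfnorm_perturbed_mulmx_le (R : realType) m n (A B : 'M[R]_(m, n))
    (u v : 'cV_n) (c : R) :
  0 <= c -> (forall a b, `|B a b - A a b| <= c) ->
  linfnorm (B *m v - A *m u) <=
  c * l1norm u + (opnorm_inf A + n%:R * c) * linfnorm (v - u).
Proof.
move=> c0 BA.
have -> : B *m v - A *m u = (B - A) *m u + (A *m (v - u) + (B - A) *m (v - u)).
  by rewrite [X in _ + (_ + X)]mulmxBl subrKC mulmxBl mulmxBr [RHS]addrC subrKA.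
have BA' (w : 'cV_n) : linfnorm ((B - A) *m w) <= c * l1norm w.
  apply: linfnorm_col_le => [|i]; first by rewrite mulr_ge0 ?l1norm_ge0.
  by apply: abs_mulmx_le_l1norm => j; rewrite !mxE.
apply: le_trans; first exact: ler_mx_norm_add.
rewrite lerD ?BA' //; apply: le_trans; first exact: ler_mx_norm_add.
rewrite mulrDl lerD ?linfnorm_le_opnorm_inf // (le_trans (BA' _)) //.
by rewrite (mulrC n%:R) -mulrA ler_wpM2l ?l1norm_le_linfnorm.
Qed.

(** Substituting [m = l - k] turns the descending product of the theorem into the ascending one of
    [layer_dist_le]. *)
Lemma prod_rev_nat (R : comPzSemiRingType) (F : nat -> R) n l :
  \prod_(1 <= k < l - n) F (l - k)%N = \prod_(n.+1 <= m < l) F m.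
Proof.
rewrite big_nat_rev -[n.+1]/(1 + n)%N big_addn.
by apply: eq_big_nat => k /andP[k1 kl]; congr F; lia.
Qed.

Theorem theorem1 (R : realType) (L : nat) (d : nat -> nat) (rho : R -> R)
    (W : weights R d) (x xhat : 'cV[R]_(d 0)) (N : nat)
    (WN : 'M[R]_(d N, d N.-1)) (epsN epsx : R)
    (rho_ge0 : forall t, 0 <= rho t)
    (rho_mono : monotone rho)
    (rho_lip : 1.-lipschitz rho)
    (hN : (1 <= N <= L)%N)
    (epsN_ge0 : 0 <= epsN) (epsx_ge0 : 0 <= epsx)
    (hWN : forall a b, `|WN a b - W N a b| <= epsN)
    (hx : forall b, `|xhat b 0 - x b 0| <= epsx)
    (i j : 'I_(d L)) :
  (N <> L ->
    margin (network rho (replace_weight W WN) L xhat) i j <=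
    margin (network rho W L x) i j +
    l1norm (row i (W L) - row j (W L)) *
    (\prod_(1 <= k < L - N) opnorm_inf (W (L - k)%N)) *
    (epsN * l1norm (layer rho W x N.-1) +
     epsx * (\prod_(1 <= m < N) opnorm_inf (W m)) *
       (opnorm_inf (W N) + (d N.-1)%:R * epsN))) /\
  (N = L -> L = 1%N \/ rho 0 = 0 ->
    margin (network rho (replace_weight W WN) L xhat) i j <=
    margin (network rho W L x) i j +
    epsx * l1norm (row i (W L) - row j (W L)) *
      (\prod_(1 <= m < L) opnorm_inf (W m)) +
    2 * epsN * (\prod_(1 <= m < L) opnorm1 (W m)) *
      (l1norm x + (d 0)%:R * epsx)).

Proof.
(* With [N] written as [n.+1], the index [N.-1] in the type of [WN] computes to [n]. *)
move: WN hWN hN; case: N => // n WN hWN /andP[_ nL].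
have rho_contr s t : `|rho s - rho t| <= `|s - t|.
  (* The Lipschitz predicate ranges over pairs in the full set; [conj I I] proves membership. *)
  by have := rho_lip (s, t) (conj I I); rewrite /= mul1r.
have linf_x : linfnorm (xhat - x) <= epsx.
  by apply: linfnorm_col_le => // b; rewrite !mxE.
have l1_x : l1norm xhat <= l1norm x + (d 0)%:R * epsx.
  rewrite -(subrKC x xhat); apply: le_trans; first exact: ler_l1normD.
  rewrite lerD2l; apply: le_trans; first exact: l1norm_le_linfnorm.
  by rewrite ler_wpM2l.
set V := replace_weight W WN.
have VN : V n.+1 = WN by apply: dfwith_in.
have VW m : m != n.+1 -> V m = W m by rewrite eq_sym; apply: dfwith_out.
have V_below m : (0 < m <= n)%N -> V m = W m by move=> ?; apply: VW; lia.
have dist_below : linfnorm (layer rho V xhat n - layer rho W x n) <=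
    epsx * \prod_(1 <= m < n.+1) opnorm_inf (W m).
  apply: (le_trans (layer_dist_le rho_contr xhat x (leq0n n) V_below)).
  rewrite mulrC ler_wpM2r //.
  by apply: prodr_ge0 => m _; apply: opnorm_inf_ge0.
split=> [/eqP nL'|LE rho0].
- have {nL'} nL : (n.+1 < L)%N by lia.
  rewrite (prod_rev_nat (fun m => opnorm_inf (W m))) /network VW ?gtn_eqF //.
  (* Both runs share [W L], so by linearity the gap between the margins is the margin of [W L]
     applied to the difference of the last hidden layers. *)
  rewrite -lerBlDl -marginN -marginD.
  rewrite -mulmxBr (le_trans (margin_mulmx_le _ _ _ _)) //.
  rewrite -mulrA ler_wpM2l ?l1norm_ge0 //.
  have nL1 : (n.+1 <= L.-1)%N by lia.
  have V_above m : (n.+1 < m <= L.-1)%N -> V m = W m by move=> ?; apply: VW; lia.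
  apply: (le_trans (layer_dist_le rho_contr xhat x nL1 V_above)).
  rewrite prednK; last by lia.
  rewrite ler_wpM2l //; first by apply: prodr_ge0 => m _; apply: opnorm_inf_ge0.
  (* What remains is the perturbed layer itself, whose input error is [dist_below]. *)
  rewrite /= VN; apply: (le_trans (linfnorm_map_le rho_contr _ _)).
  apply: (le_trans (linfnorm_perturbed_mulmx_le _ _ epsN_ge0 hWN)).
  rewrite lerD2l mulrC ler_wpM2r // addr_ge0 ?opnorm_inf_ge0 //.
  by rewrite mulr_ge0.
- subst L; rewrite /network VN /=.
  rewrite (eq_layer _ V_below) in dist_below *.
  set zh := layer rho W xhat n in dist_below *.
  set z := layer rho W x n in dist_below *.
  (* The three terms give the unperturbed margin, the input error and the weight error. The last
     keeps [zh] whole, since its l1 norm is bounded directly. *)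
  have -> : WN *m zh = W n.+1 *m z + W n.+1 *m (zh - z) + (WN - W n.+1) *m zh.
    by rewrite mulmxBr mulmxBl subrKC subrKC.
  rewrite !marginD !lerD ?lerD2l //.
  + apply: (le_trans (margin_mulmx_le _ _ _ _)).
    by rewrite [leRHS]mulrAC [leRHS]mulrC ler_wpM2l ?l1norm_ge0.
  + have WN_W a b : `|(WN - W n.+1) a b| <= epsN by rewrite !mxE.
    apply: (le_trans (margin_mulmx_entrywise_le _ _ _ WN_W)).
    rewrite -[leRHS]mulrA ler_wpM2l ?mulr_ge0 //.
    have zh_le : l1norm zh <= (\prod_(1 <= m < n.+1) opnorm1 (W m)) * l1norm xhat.
      (* If [rho 0 = 0], the Lipschitz bound against 0 gives [|rho t| <= |t|]. If [L = 1], there is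
         no hidden layer and [zh] is [xhat]. *)
      case: rho0 => [[n0]|rho00]; last first.
        by apply: l1norm_layer_le => t; have := rho_contr t 0; rewrite rho00 !subr0.
      by rewrite /zh n0 big_nil mul1r.
    apply: (le_trans zh_le); rewrite ler_wpM2l //.
    by apply: prodr_ge0 => m _; apply: opnorm1_ge0.
Qed.
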